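(* For any set $\Gamma$ of formulas, the following are equivalent over $\mathsf{HA}$: (1) $\Gamma^{\mathrm n}\text{-}\mathbf{LEM}$; (2) $(\Gamma,\Gamma^{\mathrm n})\text{-}\mathbf{DML}$.
   Context: $\mathsf{HA}$ is first-order intuitionistic (Heyting) arithmetic with connectives $\land,\lor,\to,\exists,\forall,\bot$ ($\neg\varphi$ abbreviates $\varphi\to\bot$), with function symbols for all primitive recursive functions and their defining equations, basic arithmetic axioms, and the full induction scheme. Formulas are formulas of its language and may contain free variables. For a set $\Gamma$ of formulas, $\Gamma^{\mathrm n}=\{\neg\varphi:\varphi\in\Gamma\}$. Principles: $\Gamma^{\mathrm n}\text{-}\mathbf{LEM}$: $\neg\varphi\lor\neg\neg\varphi$ ($\varphi\in\Gamma$). $(\Gamma,\Theta)\text{-}\mathbf{DML}$: $\neg(\varphi\land\psi)\to\neg\varphi\lor\neg\psi$ ($\varphi\in\Gamma$, $\psi\in\Theta$). For a principle $P$, $\mathsf{HA}+P$ is $\mathsf{HA}$ with the universal closures of all instances of $P$ added as axioms. $P$ and $Q$ are equivalent over $\mathsf{HA}$ if $\mathsf{HA}+P$ proves all instances of $Q$ and $\mathsf{HA}+Q$ proves all instances of $P$. *)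

(* Defs.v *)
From Stdlib Require Import List Arith.
From Stdlib Require Vector Fin.
Import Vector.VectorNotations.

Set Implicit Arguments.

(** Codes of primitive recursive functions, indexed by arity; each code is a
    function symbol.  [prec g h] is recursion on the first argument. *)
Inductive primrec : nat -> Type :=
| zero : primrec 0
| succ : primrec 1
| proj (n : nat) (i : Fin.t n) : primrec n
| comp (m n : nat) (f : primrec m) (gs : Vector.t (primrec n) m) : primrec n
| prec (n : nat) (g : primrec n) (h : primrec (S (S n))) : primrec (S n).

(** Variables are de Bruijn indices: below [k] quantifiers, [Var (k + i)] is
    the [i]-th free variable.  Formulas are thus identified up to renaming of
    bound variables. *)
Inductive term : Type :=
| Var (x : nat)
| App (n : nat) (f : primrec n) (ts : Vector.t term n).

Inductive form : Type :=
| Bot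
| Equal (s t : term)
| And (p q : form)
| Or (p q : form)
| Imp (p q : form)
| All (p : form)
| Ex (p : form).

Definition neg (p : form) : form := Imp p Bot.

Definition tzero : term := App zero []%vector.
Definition tsucc (t : term) : term := App succ [t]%vector.

Fixpoint subst_term (sigma : nat -> term) (t : term) : term :=
  match t with
  | Var x => sigma x
  | App f ts => App f (Vector.map (subst_term sigma) ts)
  end.

Definition shift_term : term -> term := subst_term (fun x => Var (S x)).

Definition scons (t : term) (sigma : nat -> term) (x : nat) : term :=
  match x with
  | 0 => t
  | S y => sigma y
  end.

Definition up (sigma : nat -> term) : nat -> term :=
  scons (Var 0) (fun x => shift_term (sigma x)).

Fixpoint subst (sigma : nat -> term) (p : form) : form :=
  match p with
  | Bot => Bot
  | Equal s t => Equal (subst_term sigma s) (subst_term sigma t)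
  | And p q => And (subst sigma p) (subst sigma q)
  | Or p q => Or (subst sigma p) (subst sigma q)
  | Imp p q => Imp (subst sigma p) (subst sigma q)
  | All p => All (subst (up sigma) p)
  | Ex p => Ex (subst (up sigma) p)
  end.

Definition shift : form -> form := subst (fun x => Var (S x)).

(** [inst p t] replaces variable [0] by [t] and lowers the others by one: it is
    the instance at [t] of the body [p] of a quantifier. *)
Definition inst (p : form) (t : term) : form := subst (scons t Var) p.

(** [bound_term] and [bound] give the least [n] such that all free variables are
    smaller than [n]. *)
Fixpoint bound_term (t : term) : nat :=
  match t with
  | Var x => S x
  | App _ ts => Vector.fold_right (fun s n => Nat.max (bound_term s) n) ts 0
  end.

Fixpoint bound (p : form) : nat :=
  match p with
  | Bot => 0
  | Equal s t => Nat.max (bound_term s) (bound_term t)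
  | And p q | Or p q | Imp p q => Nat.max (bound p) (bound q)
  | All p | Ex p => pred (bound p)
  end.

Definition closure (p : form) : form := Nat.iter (bound p) All p.

(** [T] is a set of axioms and [G] a list of open assumptions.  The rules
    [allI] and [exE] do not shift [T], so [T] must consist of sentences. *)
Inductive deriv (T : form -> Prop) : list form -> form -> Prop :=
| axiom G p : T p -> deriv T G p
| assume G p : In p G -> deriv T G p
| botE G p : deriv T G Bot -> deriv T G p
| andI G p q : deriv T G p -> deriv T G q -> deriv T G (And p q)
| andE1 G p q : deriv T G (And p q) -> deriv T G p
| andE2 G p q : deriv T G (And p q) -> deriv T G q
| orI1 G p q : deriv T G p -> deriv T G (Or p q)
| orI2 G p q : deriv T G q -> deriv T G (Or p q)
| orE G p q r : deriv T G (Or p q) -> deriv T (p :: G) r ->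
    deriv T (q :: G) r -> deriv T G r
| impI G p q : deriv T (p :: G) q -> deriv T G (Imp p q)
| impE G p q : deriv T G (Imp p q) -> deriv T G p -> deriv T G q
| allI G p : deriv T (map shift G) p -> deriv T G (All p)
| allE G p t : deriv T G (All p) -> deriv T G (inst p t)
| exI G p t : deriv T G (inst p t) -> deriv T G (Ex p)
| exE G p q : deriv T G (Ex p) -> deriv T (p :: map shift G) (shift q) ->
    deriv T G q
| eqI G t : deriv T G (Equal t t)
| eqE G p s t : deriv T G (Equal s t) -> deriv T G (inst p s) ->
    deriv T G (inst p t).

Definition proves (T : form -> Prop) (p : form) : Prop := deriv T nil p.

Inductive HA_open_axiom : form -> Prop :=
| succ_neq_zero t : HA_open_axiom (neg (Equal (tsucc t) tzero))
| succ_inj s t : HA_open_axiom (Imp (Equal (tsucc s) (tsucc t)) (Equal s t))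
| proj_eq n (i : Fin.t n) ts :
    HA_open_axiom (Equal (App (proj i) ts) (Vector.nth ts i))
| comp_eq m n (f : primrec m) (gs : Vector.t (primrec n) m) ts :
    HA_open_axiom
      (Equal (App (comp f gs) ts) (App f (Vector.map (fun g => App g ts) gs)))
| prec_zero_eq n (g : primrec n) (h : primrec (S (S n))) ts :
    HA_open_axiom (Equal (App (prec g h) (tzero :: ts)%vector) (App g ts))
| prec_succ_eq n (g : primrec n) (h : primrec (S (S n))) t ts :
    HA_open_axiom
      (Equal (App (prec g h) (tsucc t :: ts)%vector)
             (App h (t :: App (prec g h) (t :: ts) :: ts)%vector))
(* The induction variable is [Var 0]; the inner substitution replaces it by its
   successor and fixes the other variables. *)
| induction_scheme p :
    HA_open_axiom
      (Imp (inst p tzero)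
        (Imp (All (Imp p (subst (scons (tsucc (Var 0)) (fun x => Var (S x))) p)))
          (All p))).

Definition closures (P : form -> Prop) (p : form) : Prop :=
  exists q, P q /\ p = closure q.

Definition HA : form -> Prop := closures HA_open_axiom.

(** A principle is given as the set of its instances, which may be open. *)
Definition HA_plus (P : form -> Prop) (p : form) : Prop := HA p \/ closures P p.

Definition equivalent_over_HA (P Q : form -> Prop) : Prop :=
  (forall p, Q p -> proves (HA_plus P) p) /\
  (forall p, P p -> proves (HA_plus Q) p).

Definition negations (Gamma : form -> Prop) (p : form) : Prop :=
  exists q, Gamma q /\ p = neg q.

Definition LEM (Gamma : form -> Prop) (p : form) : Prop :=
  exists q, Gamma q /\ p = Or q (neg q).

Definition DML (Gamma Theta : form -> Prop) (p : form) : Prop :=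
  exists q r, Gamma q /\ Theta r /\ p = Imp (neg (And q r)) (Or (neg q) (neg r)).

(* Main.v *)
Require Import Defs.
From Stdlib Require Import List Lia.
From Stdlib Require Vector.

(** Write an element of [negations Gamma] as [neg q] with [q] in [Gamma].

    From weak excluded middle to De Morgan: to obtain [Or (neg p) (neg (neg q))]
    from [neg (And p (neg q))], decide [neg q].  If [neg q] holds, then [p] is
    absurd, since [And p (neg q)] is; otherwise [neg (neg q)] is the right
    disjunct.

    From De Morgan to weak excluded middle: take both conjuncts from the same
    [q].  The premise [neg (And q (neg q))] is provable, and the conclusion is
    [Or (neg q) (neg (neg q))].

    In either direction a single instance of the assumed principle is used, and
    it has to be used as an open formula, whereas the theory only has its
    universal closure as an axiom.  Passing from the closure to the open
    formula ([deriv_open_of_closure]) is where the work lies: instantiating the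
    prefix one quantifier at a time builds up a simultaneous substitution
    ([deriv_subst_of_iter_All]), which requires that substitutions compose
    ([subst_comp]) and that they do not affect sentences ([subst_ext_bound]). *)

(** The generated principle [term_ind] gives no hypothesis on the arguments of
    a function symbol, as they sit inside a vector. *)
Lemma term_nested_ind (P : term -> Prop)
  (HVar : forall x, P (Var x))
  (HApp : forall n (f : primrec n) ts, Vector.Forall P ts -> P (App f ts)) :
  forall t, P t.
Proof.
  fix IH 1.
  intros [x | n f ts].
  - apply HVar.
  - apply HApp.
    clear f.
    induction ts as [| t n ts IHts]; constructor.
    + apply IH.
    + exact IHts.
Qed.

Lemma subst_term_ext_bound (t : term) (sigma tau : nat -> term) :
  (forall x, x < bound_term t -> sigma x = tau x) ->
  subst_term sigma t = subst_term tau t.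
Proof.
  induction t as [x | n f ts IH] using term_nested_ind; simpl; intros E.
  - apply E; lia.
  - f_equal.
    clear f.
    induction IH as [| n t ts IHt _ IHts]; simpl in *.
    + reflexivity.
    + f_equal.
      * apply IHt; intros x Hx; apply E; lia.
      * apply IHts; intros x Hx; apply E; lia.
Qed.

(** Only the free variables matter.  Besides the invariance of sentences, this
    provides extensionality of [subst] without functional extensionality. *)
Lemma subst_ext_bound (p : form) : forall sigma tau : nat -> term,
  (forall x, x < bound p -> sigma x = tau x) -> subst sigma p = subst tau p.
Proof.
  induction p as [| s t | p IHp q IHq | p IHp q IHq | p IHp q IHq | p IHp | p IHp];
    simpl; intros sigma tau E.
  1: reflexivity.
  1: f_equal; apply subst_term_ext_bound; intros x Hx; apply E; lia.
  1-3: f_equal; [apply IHp | apply IHq]; intros x Hx; apply E; lia.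
  all: f_equal; apply IHp; intros [| x] Hx; simpl; [reflexivity |];
    rewrite E by lia; reflexivity.
Qed.

Lemma subst_term_Var (t : term) : subst_term Var t = t.
Proof.
  induction t as [x | n f ts IH] using term_nested_ind; simpl.
  - reflexivity.
  - f_equal.
    clear f.
    induction IH as [| n t ts IHt _ IHts]; simpl; congruence.
Qed.

Lemma subst_Var (p : form) : subst Var p = p.
Proof.
  induction p as [| s t | p IHp q IHq | p IHp q IHq | p IHp q IHq | p IHp | p IHp];
    simpl.
  1: reflexivity.
  1: now rewrite !subst_term_Var.
  1-3: congruence.
  all: f_equal; rewrite <- IHp at 2; apply subst_ext_bound;
    intros [| x] _; reflexivity.
Qed.

Lemma subst_term_comp (sigma tau : nat -> term) (t : term) :
  subst_term tau (subst_term sigma t)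
  = subst_term (fun x => subst_term tau (sigma x)) t.
Proof.
  induction t as [x | n f ts IH] using term_nested_ind; simpl.
  - reflexivity.
  - f_equal.
    clear f.
    induction IH as [| n t ts IHt _ IHts]; simpl; congruence.
Qed.

Lemma up_comp (sigma tau : nat -> term) (x : nat) :
  subst_term (up tau) (up sigma x) = up (fun y => subst_term tau (sigma y)) x.
Proof.
  destruct x as [| x]; simpl.
  - reflexivity.
  - unfold shift_term; rewrite !subst_term_comp; reflexivity.
Qed.

Lemma subst_comp (p : form) : forall sigma tau : nat -> term,
  subst tau (subst sigma p) = subst (fun x => subst_term tau (sigma x)) p.
Proof.
  induction p as [| s t | p IHp q IHq | p IHp q IHq | p IHp q IHq | p IHp | p IHp];
    simpl; intros sigma tau.
  1: reflexivity.
  1: now rewrite !subst_term_comp.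
  1-3: now rewrite IHp, IHq.
  all: f_equal; rewrite IHp; apply subst_ext_bound; intros x _; apply up_comp.
Qed.

Lemma inst_subst_up (sigma : nat -> term) (p : form) (t : term) :
  inst (subst (up sigma) p) t = subst (scons t sigma) p.
Proof.
  unfold inst; rewrite subst_comp.
  apply subst_ext_bound; intros [| x] _; simpl.
  - reflexivity.
  - unfold shift_term; rewrite subst_term_comp; apply subst_term_Var.
Qed.

(** The ambient substitution [sigma] makes the induction on the prefix go
    through: stripping the outermost quantifier replaces it by [scons t sigma],
    so that [sigma] accumulates the witnesses, the innermost one last. *)
Lemma deriv_subst_of_iter_All (T : form -> Prop) (G : list form) (p : form)
  (tau : nat -> term) (n : nat) : forall sigma : nat -> term,
  (forall i, tau (n + i) = sigma i) ->
  deriv T G (subst sigma (Nat.iter n All p)) -> deriv T G (subst tau p).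
Proof.
  induction n as [| n IH]; simpl; intros sigma E H.
  - rewrite (subst_ext_bound p tau sigma); auto.
  - apply (IH (scons (tau n) sigma)).
    + intros [| i]; simpl.
      * f_equal; lia.
      * rewrite <- E; f_equal; lia.
    + rewrite <- inst_subst_up; apply allE; exact H.
Qed.

Lemma bound_iter_All (p : form) (n : nat) :
  bound (Nat.iter n All p) = bound p - n.
Proof.
  induction n as [| n IH]; simpl; lia.
Qed.

Lemma deriv_open_of_closure (T : form -> Prop) (G : list form) (p : form) :
  deriv T G (closure p) -> deriv T G p.
Proof.
  intros H.
  rewrite <- (subst_Var p).
  (* After the prefix is stripped, [sigma] acts on the variables from [bound p]
     on; shifting by [bound p] makes the resulting substitution the identity,
     and costs nothing because [closure p] is a sentence. *)
  apply (deriv_subst_of_iter_All T G p Var (bound p)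
           (fun i => Var (bound p + i))).
  - reflexivity.
  - rewrite (subst_ext_bound _ _ Var), subst_Var.
    + exact H.
    + rewrite bound_iter_All; lia.
Qed.

Lemma deriv_instance (P : form -> Prop) (G : list form) (p : form) :
  P p -> deriv (HA_plus P) G p.
Proof.
  intros H.
  apply deriv_open_of_closure, axiom; right; exists p; auto.
Qed.

Theorem proposition5p5 (Gamma : form -> Prop) :
  equivalent_over_HA (LEM (negations Gamma)) (DML Gamma (negations Gamma)).
Proof.
  split.
  - intros f (p & r & _ & (q & Hq & ->) & ->).
    apply impI, (@orE _ _ (neg q) (neg (neg q))).
    + apply deriv_instance.
      exists (neg q); split; [exists q |]; auto.
    + apply orI1, impI, (@impE _ _ (And p (neg q))).
      * apply assume; simpl; auto.
      * apply andI; apply assume; simpl; auto.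
    + apply orI2, assume; simpl; auto.
  - intros f (r & (q & Hq & ->) & ->).
    apply (@impE _ _ (neg (And q (neg q)))).
    + apply deriv_instance.
      exists q, (neg q); repeat split; [| exists q]; auto.
    + apply impI, (@impE _ _ q).
      * apply (@andE2 _ _ q), assume; simpl; auto.
      * apply (@andE1 _ _ _ (neg q)), assume; simpl; auto.
Qed.
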